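(* The diagonal spectral gap satisfies \[ \mathrm{gap}(\mathcal A)\ge\mu^2\Big(\sum_{k\ge0}\frac{\nu^{2k}}{k+r}\Big)^{-1}=\mu^2\nu^{2r}\Big(2\int_0^\nu\frac{s^{2r-1}}{1-s^2}\,ds\Big)^{-1}. \]
   Context: Fix $r>0$ and $0<\lambda<\mu$, put $\nu=\lambda/\mu$ and $\omega_n=n(n+r-1)$. Let $\mathcal A$ be the generator of the birth-and-death process on $\mathbb N$ acting as $(\mathcal Af)_j=\lambda^2\omega_{j+1}(f_{j+1}-f_j)+\mu^2\omega_j(f_{j-1}-f_j)$ (this is the action of the quadratic open quantum harmonic oscillator generator on diagonal operators $\sum_jf_j|e_j\rangle\langle e_j|$). Its invariant measure is $\pi_j=(1-\nu^2)\nu^{2j}$. The (diagonal) spectral gap is \[ \mathrm{gap}(\mathcal A)=\inf\Big\{\sum_{j\ge0}\lambda^2\omega_{j+1}|f_{j+1}-f_j|^2\pi_j:\ \sum_j\pi_j|f_j|^2=1,\ \sum_j\pi_jf_j=0\Big\}, \] which equals the infimum of the Dirichlet form $\mathcal E(\xi)=-\mathrm{Re}\langle\xi,L\xi\rangle$ over unit diagonal Hilbert–Schmidt operators $\xi=\sum_j\pi_j^{1/2}f_j|e_j\rangle\langle e_j|$ orthogonal to $\rho^{1/2}$, $\rho=\sum_j\pi_j|e_j\rangle\langle e_j|$. *)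

(* Defs.v *)
From HB Require Import structures.
From mathcomp Require Import all_boot all_order all_algebra.
From mathcomp Require Import all_classical all_reals all_analysis.
Set Implicit Arguments. Unset Strict Implicit. Unset Printing Implicit Defensive.
Import Order.TTheory GRing.Theory Num.Theory numFieldNormedType.Exports.
Local Open Scope classical_set_scope.
Local Open Scope ring_scope.

Definition omega (R : realType) (r : R) (n : nat) : R := n%:R * (n%:R + r - 1).

Definition piw (R : realType) (lam mu : R) (j : nat) : R :=
  (1 - (lam / mu) ^+ 2) * (lam / mu) ^+ (2 * j).

(* A complex-valued function f : nat -> C is encoded by its real and
   imaginary parts a, b : nat -> R, so that |f_j|^2 = a_j^2 + b_j^2. *)

Definition dirichlet (R : realType) (r lam mu : R) (a b : nat -> R) : \bar R :=
  (\sum_(j <oo) (lam ^+ 2 * omega r j.+1 *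
     ((a j.+1 - a j) ^+ 2 + (b j.+1 - b j) ^+ 2) * piw lam mu j)%:E)%E.

Definition admissible (R : realType) (lam mu : R) (a b : nat -> R) : Prop :=
  (\sum_(j <oo) (piw lam mu j * (a j ^+ 2 + b j ^+ 2))%:E)%E = 1%E /\
  series (fun j => piw lam mu j * a j) @ \oo --> (0 : R) /\
  series (fun j => piw lam mu j * b j) @ \oo --> (0 : R).

Definition gap (R : realType) (r lam mu : R) : \bar R :=
  ereal_inf [set dirichlet r lam mu ab.1 ab.2 | ab in
               [set ab : (nat -> R) * (nat -> R) | admissible lam mu ab.1 ab.2]].

(* Main.v *)
(* Put q = nu^2, pi_j = (1-q) q^j and s_l = sum_k q^k / (k+l+r), so that S = s_0.
   Summation by parts against the flux F_k = sum_(j <= k) pi_j f_j turns the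
   Poincare inequality into a weighted Hardy inequality for F. The latter follows
   from the test function with increments 1/(k+r): its centred tail sums are
   H_k = (1-q) q^(k+1) (s_0 + ... + s_k), and s_l <= s_0 gives
   H_k <= S (1-q) (k+1) q^(k+1), with equality at k = 0. All of this is done on
   {0..N} for f centred there, where the boundary flux F_N vanishes, and then
   N tends to infinity. The integral formula is termwise integration of the
   geometric series of s^(2r-1) / (1-s^2). *)

Require Import Defs.
From HB Require Import structures.
From mathcomp Require Import all_boot all_order all_algebra.
From mathcomp Require Import all_classical all_reals all_analysis.
From mathcomp Require Import measurable_realfun ring lra.
Import Order.TTheory GRing.Theory Num.Theory numFieldNormedType.Exports.
Local Open Scope classical_set_scope.
Local Open Scope ring_scope.

(** * Weighted Hardy and Poincare inequalities on a finite segment *)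

Section WeightedPoincare.
Variables (R : realFieldType) (p H V w : nat -> R) (c : R).
Hypothesis p_gt0 : forall j, 0 < p j.
Hypothesis H_gt0 : forall j, 0 < H j.
(** [H0E] and [HSE] make [H k] minus the partial sum of [V * p] up to [k], that is, the tail sum
    beyond [k] when [V] is centred. [H_le] is the supersolution condition that makes [c] a Poincare
    constant. *)
Hypothesis H0E : H 0%N = - (V 0%N * p 0%N).
Hypothesis HSE : forall j, H j - H j.+1 = V j.+1 * p j.+1.
Hypothesis H_le : forall j, H j <= c * w j * (V j.+1 - V j).
Hypothesis cw_gt0 : forall j, 0 < c * w j.

Let flux (f : nat -> R) k := \sum_(0 <= j < k.+1) p j * f j.

Let fluxS f k : flux f k.+1 = flux f k + p k.+1 * f k.+1.
Proof. by rewrite /flux big_nat_recr. Qed.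

(* With [F, F'] and [H, H'] consecutive values, the inequality is the sum of
   [(F' - F)^2 >= (H' - H) (F'^2 / H' - F^2 / H)], whose defect is the square
   [(F H' - F' H)^2 / (H H')], after a summation by parts. *)
Lemma flux_hardy f N :
  \sum_(0 <= k < N) flux f k ^+ 2 * ((V k.+1 - V k) / H k)
    - V N * flux f N ^+ 2 / H N
  <= \sum_(0 <= j < N.+1) p j * f j ^+ 2.
Proof.
elim: N => [|N IH].
  rewrite big_geq // big_nat1 /flux big_nat1.
  have p0 := p_gt0 0; have Hn := H_gt0 0.
  have V0 : V 0%N = - H 0%N / p 0%N by rewrite H0E; field; rewrite lt0r_neq0.
  rewrite V0 le_eqVlt; apply/orP; left; apply/eqP; field.
  by rewrite !lt0r_neq0.
rewrite big_nat_recr //= [leRHS]big_nat_recr //=.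
have pS := p_gt0 N.+1; have h := H_gt0 N; have h' := H_gt0 N.+1.
have fE : f N.+1 = (flux f N.+1 - flux f N) / p N.+1.
  by rewrite fluxS; field; rewrite lt0r_neq0.
have VE : V N.+1 = (H N - H N.+1) / p N.+1.
  by rewrite HSE; field; rewrite lt0r_neq0.
set F := flux f N in IH fE *; set F' := flux f N.+1 in fE *.
have defect : p N.+1 * f N.+1 ^+ 2 =
    F ^+ 2 * V N.+1 / H N - V N.+1 * F' ^+ 2 / H N.+1
      + (F * H N.+1 - F' * H N) ^+ 2 / (H N * H N.+1 * p N.+1).
  by rewrite fE VE; field; rewrite !lt0r_neq0.
have defect_ge0 : 0 <= (F * H N.+1 - F' * H N) ^+ 2 / (H N * H N.+1 * p N.+1).
  by rewrite divr_ge0 ?sqr_ge0 // !mulr_ge0 // ltW.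
have <- : F ^+ 2 * V N.+1 / H N - V N * F ^+ 2 / H N =
    F ^+ 2 * ((V N.+1 - V N) / H N) by field; rewrite lt0r_neq0.
lra.
Qed.

Lemma flux_by_parts f N :
  \sum_(0 <= j < N.+1) p j * f j ^+ 2 =
  flux f N * f N - \sum_(0 <= k < N) flux f k * (f k.+1 - f k).
Proof.
elim: N => [|N IH]; first by rewrite big_nat1 /flux big_nat1 big_geq //; ring.
by rewrite big_nat_recr //= IH [X in _ = _ - X]big_nat_recr //= fluxS; ring.
Qed.

Lemma centered_poincare f N : flux f N = 0 ->
  \sum_(0 <= j < N.+1) p j * f j ^+ 2
  <= c * \sum_(0 <= k < N) w k * (f k.+1 - f k) ^+ 2.
Proof.
move=> F0; have := flux_hardy f N; have := flux_by_parts f N.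
rewrite F0 mul0r add0r expr0n /= mulr0 mul0r subr0 => parts hardy.
(* By [parts] the left side is twice the weighted square sum of [f]. By [hardy] the first sum on the
   right is at most one copy of it, which is absorbed. *)
suff : - (2 * \sum_(0 <= k < N) flux f k * (f k.+1 - f k)) <=
    \sum_(0 <= k < N) flux f k ^+ 2 * ((V k.+1 - V k) / H k)
    + c * \sum_(0 <= k < N) w k * (f k.+1 - f k) ^+ 2 by lra.
rewrite !mulr_sumr -sumrN -big_split /=; apply: ler_sum => k _.
set F := flux f k; set d := f k.+1 - f k.
have cw := cw_gt0 k; have h := H_gt0 k.
have : F ^+ 2 / (c * w k) <= F ^+ 2 * ((V k.+1 - V k) / H k).
  apply: ler_wpM2l; first exact: sqr_ge0.
  by rewrite ler_pdivlMr // mulrC ler_pdivrMr // mulrC.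
(* Expanding this square gives Young's inequality with weight [c * w k]; its term in [F ^+ 2] is the
   one just bounded through [H_le]. *)
have : 0 <= (F + c * w k * d) ^+ 2 / (c * w k).
  by rewrite divr_ge0 ?sqr_ge0 // ltW.
rewrite [c * (w k * _)]mulrA; move: (c * w k) cw => x x_gt0.
have -> : (F + x * d) ^+ 2 / x = F ^+ 2 / x + 2 * (F * d) + x * d ^+ 2.
  by field; rewrite lt0r_neq0.
lra.
Qed.

Lemma weighted_poincare f N :
  \sum_(0 <= j < N.+1) p j * f j ^+ 2
    - (\sum_(0 <= j < N.+1) p j * f j) ^+ 2 / \sum_(0 <= j < N.+1) p j
  <= c * \sum_(0 <= k < N) w k * (f k.+1 - f k) ^+ 2.
Proof.
set P := \sum_(0 <= j < N.+1) p j; set M := \sum_(0 <= j < N.+1) p j * f j.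
have P_gt0 : 0 < P.
  rewrite /P big_nat_recr //= ltr_wpDl //.
  by apply: sumr_ge0 => j _; exact: ltW.
have sumM (m : R) : \sum_(0 <= j < N.+1) p j * (f j - m) = M - m * P.
  rewrite /M /P mulr_sumr -sumrB; apply: eq_bigr => j _; ring.
have sumsq (m : R) : \sum_(0 <= j < N.+1) p j * (f j - m) ^+ 2 =
    \sum_(0 <= j < N.+1) p j * f j ^+ 2 - 2 * m * M + m ^+ 2 * P.
  rewrite /M /P !mulr_sumr -sumrB -big_split; apply: eq_bigr => j _ /=; ring.
(* Subtracting the mean over [{0..N}] kills the boundary flux and leaves the increments
   unchanged. *)
have F0 : flux (fun j => f j - M / P) N = 0.
  by rewrite /flux sumM; field; rewrite lt0r_neq0.
have := centered_poincare _ _ F0.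
under [X in _ <= c * X -> _]eq_bigr => k _.
  rewrite (_ : f k.+1 - M / P - _ = f k.+1 - f k); last by ring.
  over.
apply: le_trans; rewrite le_eqVlt; apply/orP; left; apply/eqP.
by rewrite sumsq; field; rewrite lt0r_neq0.
Qed.

End WeightedPoincare.

(** * The shifted series of q^k / (k + l + r) *)

Section ReciprocalGeometricSeries.
Context {R : realType} (q r : R).
Hypothesis q_gt0 : 0 < q.
Hypothesis q_lt1 : q < 1.
Hypothesis r_gt0 : 0 < r.

(** The shift [l] makes [q ^+ l * recip_sum l] the tail from index [l] of the series defining
    [recip_sum 0]. *)
Definition recip_geom (l k : nat) : R := q ^+ k / (k%:R + l%:R + r).
Definition recip_sum (l : nat) : R := limn (series (recip_geom l)).

Lemma recip_geom_gt0 l k : 0 < recip_geom l k.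
Proof. by rewrite divr_gt0 ?exprn_gt0 // ltr_wpDl // addr_ge0. Qed.

Lemma recip_geom_le l k : recip_geom l k <= recip_geom 0 k.
Proof.
apply: ler_wpM2l; first by rewrite exprn_ge0 // ltW.
rewrite lef_pV2 ?posrE; first by rewrite lerD2r lerD2l ler_nat.
  by rewrite ltr_wpDl // addr_ge0.
by rewrite ltr_wpDl // addr_ge0.
Qed.

Lemma is_cvg_recip l : cvgn (series (recip_geom l)).
Proof.
apply: (@series_le_cvg _ _ (geometric r^-1 q)).
- by move=> k; exact/ltW/recip_geom_gt0.
- by move=> k; rewrite /= mulr_ge0 ?invr_ge0 ?exprn_ge0 // ltW.
- move=> k; rewrite /recip_geom /= mulrC ler_wpM2r //.
    by rewrite exprn_ge0 // ltW.
  by rewrite lef_pV2 ?posrE ?ltr_wpDl // ?lerDr addr_ge0.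
- by apply: is_cvg_geometric_series; rewrite ger0_norm // ltW.
Qed.

Lemma recip_sum_le l : recip_sum l <= recip_sum 0.
Proof.
by apply: lim_series_le; [exact: is_cvg_recip|exact: is_cvg_recip|
  exact: recip_geom_le].
Qed.

(** Splitting off the first term leaves [q] times the series with shift [l.+1]. This recursion
    collapses the increments of the test function to [1 / (k + r)]. *)
Lemma recip_sum_rec l : recip_sum l = (l%:R + r)^-1 + q * recip_sum l.+1.
Proof.
have shift n : series (recip_geom l) n.+1 =
    (l%:R + r)^-1 + q * series (recip_geom l.+1) n.
  rewrite /series /= big_nat_recl // /recip_geom expr0 add0r div1r; congr (_ + _).
  rewrite mulr_sumr; apply: eq_bigr => k _.
  by rewrite exprS -mulrA -!natr1 [k%:R + 1 + _]addrAC addrA.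
apply/cvg_lim => //; rewrite -cvg_shiftS /=; under eq_cvg do rewrite shift.
by apply: cvgD; [exact: cvg_cst|apply: cvgMr; exact: is_cvg_recip].
Qed.

Lemma recip_sum_gt0 l : 0 < recip_sum l.
Proof.
apply: lt_le_trans (recip_geom_gt0 l 0) _.
have -> : recip_geom l 0 = series (recip_geom l) 1.
  by rewrite /series /= big_nat1.
apply: nondecreasing_cvgn_le; last exact: is_cvg_recip.
by apply: nondecreasing_series => k _ _; exact/ltW/recip_geom_gt0.
Qed.

End ReciprocalGeometricSeries.

(** * Poincare inequality for geometric weights *)

Section GeometricPoincare.
Context {R : realType} (q r : R) (p : nat -> R).
Hypothesis q_gt0 : 0 < q.
Hypothesis q_lt1 : q < 1.
Hypothesis r_gt0 : 0 < r.
Hypothesis pE : forall j, p j = (1 - q) * q ^+ j.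

Let S := recip_sum q r.

(** For [q = (lam / mu) ^+ 2] and [p = piw lam mu], the edge weight is
    [lam ^+ 2 * omega r k.+1 * p k / mu ^+ 2], so the right side is a truncated Dirichlet form up to
    the factor [S 0 / mu ^+ 2]. *)
Lemma geometric_poincare (f : nat -> R) N :
  \sum_(0 <= j < N.+1) p j * f j ^+ 2
    - (\sum_(0 <= j < N.+1) p j * f j) ^+ 2 / \sum_(0 <= j < N.+1) p j
  <= S 0 * \sum_(0 <= k < N)
       q * (k.+1%:R * (k%:R + r)) * p k * (f k.+1 - f k) ^+ 2.
Proof.
have q1 : 0 < 1 - q by rewrite subr_gt0.
have p_gt0 j : 0 < p j by rewrite pE mulr_gt0 // exprn_gt0.
have S_gt0 l : 0 < S l by exact: recip_sum_gt0.
have w_gt0 k : 0 < S 0 * (q * (k.+1%:R * (k%:R + r)) * p k).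
  have kr : 0 < k%:R + r by rewrite ltr_wpDl.
  by rewrite !mulr_gt0.
pose T n := \sum_(0 <= l < n) S l.
have TS n : T n.+1 = T n + S n by rewrite /T big_nat_recr.
(* Up to centring, the test function is [V j = sum_(k < j) 1 / (k + r)]; [H j]
   is the tail sum of [p * V] beyond [j], computed by [recip_sum_rec]. *)
apply: (@weighted_poincare _ p (fun k => (1 - q) * q ^+ k.+1 * T k.+1)
  (fun j => T j - q * T j.+1) (fun k => q * (k.+1%:R * (k%:R + r)) * p k)) => //.
- move=> k; rewrite !mulr_gt0 ?exprn_gt0 // TS ltr_wpDl //.
  by apply: sumr_ge0 => l _; exact: ltW.
- by rewrite ?pE TS /T big_geq // expr1 expr0; ring.
- by move=> j; rewrite ?pE !exprS; ring.
- move=> k; have -> : T k.+1 - q * T k.+2 - (T k - q * T k.+1) = (k%:R + r)^-1.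
    by rewrite !TS /S (recip_sum_rec q r q_gt0 q_lt1 r_gt0 k); ring.
  have -> : S 0 * (q * (k.+1%:R * (k%:R + r)) * p k) / (k%:R + r) =
      (1 - q) * q ^+ k.+1 * (S 0 * k.+1%:R).
    by rewrite ?pE exprS; field; rewrite lt0r_neq0 // ltr_wpDl.
  (* Without the common factor, [H_le] reads [T k.+1 <= S 0 * k.+1%:R], which holds term by term. *)
  rewrite ler_pM2l ?mulr_gt0 ?exprn_gt0 //.
  have -> : S 0 * k.+1%:R = \sum_(0 <= l < k.+1) S 0.
    by rewrite sumr_const_nat subn0 mulr_natr.
  by apply: ler_sum => l _; exact: recip_sum_le.
Qed.

End GeometricPoincare.

(** * Integrals of real powers down to 0 *)

Section PowerIntegrals.
Context {R : realType}.
Local Notation mu := (@lebesgue_measure R).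

(** Denominators start at 2 so that every interval is nondegenerate, as [integral_powR_pos]
    requires. *)
Lemma itvoc0_bigcup (b : R) : 0 < b ->
  `]0, b]%classic = \bigcup_n `[b / n.+2%:R, b]%classic.
Proof.
move=> b0; apply/seteqP; split => [x /=|x [n _] /=]; rewrite !in_itv /=.
  move=> /andP[x0 xb]; exists (Num.truncn (b / x)) => //=.
  rewrite in_itv /= xb andbT ler_pdivrMr // mulrC -ler_pdivrMr //.
  have /truncn_itv /andP[_ /ltW h] : 0 <= b / x by rewrite divr_ge0 // ltW.
  by apply: le_trans h _; rewrite ler_nat.
move=> /andP[nx ->]; rewrite andbT; apply: lt_le_trans nx.
by rewrite divr_gt0.
Qed.

Lemma powR_within_continuous (e a b : R) : 0 < a ->
  {within `[a, b], continuous (fun x : R => x `^ e)}.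
Proof.
move=> a0; apply: derivable_within_continuous => x; rewrite in_itv /= => /andP[ax _].
by apply: derivable_powR; rewrite in_itv /= andbT (lt_le_trans a0).
Qed.

Lemma integral_powR_pos (e a b : R) : e != 0 -> 0 < a -> a < b ->
  (\int[mu]_(x in `[a, b]) (x `^ (e - 1))%:E = (b `^ e / e - a `^ e / e)%:E)%E.
Proof.
move=> e0 a0 ab; rewrite EFinB.
pose F (x : R) : R := x `^ e / e.
have dF (x : R) : 0 < x -> is_derive x 1 F (x `^ (e - 1)).
  move=> x0; have Dx := is_derive1_powR e x0.
  apply: is_derive_eq.
  by rewrite /GRing.scale /=; field.
have cF : {within `[a, b], continuous F}.
  apply: derivable_within_continuous => x; rewrite in_itv /= => /andP[ax _].
  by have [] := dF x (lt_le_trans a0 ax).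
apply: (@continuous_FTC2 _ _ F) => //.
- exact: powR_within_continuous.
- have [_ Fa Fb] := (continuous_within_itvP F ab).1 cF.
  split => // x; rewrite in_itv /= => /andP[ax _].
  by have [] := dF x (lt_trans a0 ax).
- move=> x; rewrite in_itv /= => /andP[ax _].
  by rewrite derive1E; apply: derive_val; exact: dF (lt_trans a0 ax).
Qed.

(** For [e < 1] the integrand is unbounded near 0, so the fundamental theorem of calculus is applied
    away from 0 and monotone convergence passes to the union. *)
Lemma integral_powR (e b : R) : 0 < e -> 0 < b ->
  (\int[mu]_(x in `]0%R, b]) (x `^ (e - 1))%:E = (b `^ e / e)%:E)%E.
Proof.
move=> e0 b0; rewrite itvoc0_bigcup //.
have b_lt n : b / n.+2%:R < b.
  by rewrite ltr_pdivrMr // ltr_pMr // ltr1n.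
have cvgI : (\int[mu]_(x in `[(b / n.+2%:R)%R, b]) (x `^ (e - 1))%:E)%E @[n --> \oo] -->
    (\int[mu]_(x in \bigcup_n `[(b / n.+2%:R)%R, b]%classic) (x `^ (e - 1))%:E)%E.
  apply: ge0_nondecreasing_set_cvg_integral => //.
  - apply/nondecreasing_seqP => n; rewrite subsetEset; apply: subset_itvr.
    by rewrite bnd_simp ler_pM2l // lef_pV2 ?posrE // ler_nat.
  - move=> n; apply/measurable_EFinP; apply: measurable_funTS.
    exact: measurable_powR.
  - by move=> n x _; rewrite lee_fin powR_ge0.
suff : (\int[mu]_(x in `[(b / n.+2%:R)%R, b]) (x `^ (e - 1))%:E)%E @[n --> \oo]
    --> (b `^ e / e)%:E by exact: cvg_unique cvgI.
under eq_cvg do rewrite integral_powR_pos ?gt_eqF ?divr_gt0 //.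
apply: cvg_EFin; first exact: nearW.
rewrite -[X in _ --> X]subr0; apply: cvgB; first exact: cvg_cst.
rewrite -[X in _ --> X](mul0r e^-1); apply: cvgMl.
apply: (cvg_at_rightP _ _ _).1 (powR_cvg0 e0) _ _; split.
  by move=> n; rewrite divr_gt0.
rewrite -[X in _ --> X](mulr0 b); apply: cvgMr.
(* The harmonic sequence is [1 / (n + 1)]; one shift gives [1 / (n + 2)]. *)
have := @cvg_harmonic R; rewrite -cvg_shiftS; apply: cvg_trans.
exact: cvg_refl.
Qed.

End PowerIntegrals.

(** * Passing between extended-real and real series *)

Lemma eseries_EFin {R : realType} (u : nat -> R) : cvgn (series u) ->
  (\sum_(n <oo) (u n)%:E = (limn (series u))%:E)%E.
Proof.
move=> cu; rewrite -EFin_lim //; congr (limn _).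
by apply/funext => n /=; rewrite /series /= -sumEFin.
Qed.

Lemma cvg_series_nneseries {R : realType} (u : nat -> R) (l : R) :
  (forall n, 0 <= u n) -> (\sum_(n <oo) (u n)%:E = l%:E)%E ->
  series u @ \oo --> l.
Proof.
move=> u_ge0 ul; have : (\sum_(0 <= k < n) (u k)%:E)%E @[n --> \oo] --> l%:E.
  by rewrite -ul; apply: is_cvg_nneseries => n _ _; rewrite lee_fin.
move=> /fine_cvg; apply: cvg_trans; apply: near_eq_cvg; near=> n.
by rewrite /= sumEFin.
Unshelve. all: by end_near. Qed.

(** * The integral of s^(2r-1) / (1 - s^2) *)

Section GeometricPowerIntegral.
Context {R : realType} (nu r : R).
Hypothesis nu_gt0 : 0 < nu.
Hypothesis nu_lt1 : nu < 1.
Hypothesis r_gt0 : 0 < r.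
Local Notation mu := (@lebesgue_measure R).
Local Notation g := (fun s : R => s `^ (2 * r - 1) / (1 - s ^+ 2)).

Lemma measurable_geometric_powR : measurable_fun `[0, nu] g.
Proof.
apply: measurable_funM.
  by apply: measurable_funTS; exact: measurable_powR.
apply: subspace_continuous_measurable_fun => //.
apply: derivable_within_continuous => x; rewrite in_itv /= => /andP[x0 xnu].
apply: derivableV => //.
by rewrite subr_eq0 gt_eqF // expr_lt1 // (le_lt_trans xnu).
Qed.

Lemma geometric_powR_series (s : R) : 0 < s -> s < 1 ->
  ((g s)%:E = \sum_(k <oo) (s `^ (2 * (k%:R + r) - 1))%:E)%E.
Proof.
move=> s0 s1.
have E : (fun k : nat => s `^ (2 * (k%:R + r) - 1)) =
    geometric (s `^ (2 * r - 1)) (s ^+ 2).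
  apply/funext => k /=; rewrite -exprM -powR_mulrn 1?ltW // -powRD.
    by congr powR; rewrite natrM; ring.
  by apply/implyP => _; rewrite gt_eqF.
have q1 : `|s ^+ 2| < 1 by rewrite ger0_norm ?sqr_ge0 // expr_lt1 // ltW.
rewrite eseries_EFin; last by rewrite E; exact: is_cvg_geometric_series.
by rewrite E; congr EFin; apply/esym/cvg_lim => //; exact: cvg_geometric_series.
Qed.

Lemma integral_geometric_powR :
  (\int[mu]_(s in `[0%R, nu]) (g s)%:E =
   (nu `^ (2 * r) / 2 * recip_sum (nu ^+ 2) r 0)%:E)%E.
Proof.
have q_gt0 : 0 < nu ^+ 2 by rewrite exprn_gt0.
have q_lt1 : nu ^+ 2 < 1 by rewrite expr_lt1 // ltW.
have mg : measurable_fun `]0, nu] (EFin \o g).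
  apply/measurable_EFinP.
  apply: measurable_funS measurable_geometric_powR => //.
  by move=> x /=; rewrite !in_itv /= => /andP[/ltW -> ->].
(* The null set [{0}] is dropped, since the expansion is available only for [s > 0]. *)
rewrite -integral_itv_obnd_cbnd //.
transitivity (\int[mu]_(s in `]0%R, nu])
    \sum_(k <oo) (s `^ (2 * (k%:R + r) - 1))%:E)%E.
  apply: eq_integral => s; rewrite inE /= in_itv /= => /andP[s0 snu].
  by apply: geometric_powR_series => //; exact: le_lt_trans nu_lt1.
(* Sum and integral are exchanged by nonnegativity; the term of index [k] integrates to
   [nu^(2(k+r)) / (2(k+r))]. *)
rewrite integral_nneseries //; first last.
- by move=> k s _; rewrite lee_fin powR_ge0.
- move=> k; apply/measurable_EFinP; apply: measurable_funTS.
  exact: measurable_powR.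
transitivity (\sum_(k <oo)
    ((nu `^ (2 * r) / 2)%:E * (recip_geom (nu ^+ 2) r 0 k)%:E))%E.
  apply: eq_eseriesr => k _.
  have kr : 0 < k%:R + r by rewrite ltr_wpDl.
  rewrite integral_powR ?mulr_gt0 // -EFinM /recip_geom; congr EFin.
  have -> : nu `^ (2 * (k%:R + r)) = nu `^ (2 * r) * (nu ^+ 2) ^+ k.
    rewrite -exprM -powR_mulrn 1?ltW // -powRD.
      by congr powR; rewrite natrM; ring.
    by apply/implyP => _; rewrite gt_eqF.
  rewrite addr0; field; rewrite !gt_eqF //.
have c_ge0 k : 0 <= recip_geom (nu ^+ 2) r 0 k by exact/ltW/recip_geom_gt0.
rewrite nneseriesZl; last by move=> k _; rewrite lee_fin; exact: c_ge0.
by rewrite eseries_EFin; [rewrite -EFinM|exact: is_cvg_recip].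
Qed.

(** [Rintegral] takes [fine] of the integral, which would turn an infinite value into 0;
    integrability certifies that the integral formula is meaningful. *)
Lemma integrable_geometric_powR : mu.-integrable `[0, nu] (EFin \o g).
Proof.
apply/integrableP; split.
  by apply/measurable_EFinP; exact: measurable_geometric_powR.
suff -> : (\int[mu]_(s in `[0%R, nu]) `|(EFin \o g) s| =
    \int[mu]_(s in `[0%R, nu]) (g s)%:E)%E by rewrite integral_geometric_powR ltry.
apply: eq_integral => s; rewrite inE /= in_itv /= => /andP[s0 snu].
rewrite ger0_norm // divr_ge0 ?powR_ge0 // subr_ge0 exprn_ile1 //.
exact: le_trans (ltW nu_lt1).
Qed.

End GeometricPowerIntegral.

(** * Passage to the limit in the finite Poincare inequalities *)

Lemma dirichlet_lower_bound (R : realType) (r lam mu : R) (a b : nat -> R) :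
  0 < r -> 0 < lam -> lam < mu -> admissible lam mu a b ->
  ((mu ^+ 2 / recip_sum ((lam / mu) ^+ 2) r 0)%:E
     <= dirichlet r lam mu a b)%E.
Proof.
move=> r_gt0 lam_gt0 lam_mu [norm1 [Ma0 Mb0]].
have mu_gt0 : 0 < mu := lt_trans lam_gt0 lam_mu.
set q := (lam / mu) ^+ 2; set S := recip_sum q r 0.
have q_gt0 : 0 < q by rewrite exprn_gt0 // divr_gt0.
have q_lt1 : q < 1.
  by rewrite expr_lt1 // ?divr_ge0 ?(ltW lam_gt0) ?(ltW mu_gt0) //
    ltr_pdivrMr // mul1r.
have q1 : 0 < 1 - q by rewrite subr_gt0.
have S_gt0 : 0 < S by exact: recip_sum_gt0.
have lamE : lam ^+ 2 = mu ^+ 2 * q by rewrite /q; field; rewrite gt_eqF.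
have pE j : piw lam mu j = (1 - q) * q ^+ j by rewrite /piw exprM.
have p_gt0 j : 0 < piw lam mu j by rewrite pE mulr_gt0 // exprn_gt0.
pose p j : R := piw lam mu j.
pose e j : R := lam ^+ 2 * omega r j.+1 *
  ((a j.+1 - a j) ^+ 2 + (b j.+1 - b j) ^+ 2) * p j.
have e_ge0 j : 0 <= e j.
  have w0 : 0 <= omega r j.+1.
    by rewrite /omega mulr_ge0 // -natr1 addrAC addrK addr_ge0 // ltW.
  apply: mulr_ge0 (ltW (p_gt0 j)).
  exact: mulr_ge0 (mulr_ge0 (sqr_ge0 _) w0) (addr_ge0 (sqr_ge0 _) (sqr_ge0 _)).
(* The truncation of an admissible function need not be centred; the squared partial means stay as
   an error that vanishes in the limit. *)
have finite N : \sum_(0 <= j < N.+1) p j * (a j ^+ 2 + b j ^+ 2)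
    <= S / mu ^+ 2 * \sum_(0 <= j < N) e j
      + ((\sum_(0 <= j < N.+1) p j * a j) ^+ 2
         + (\sum_(0 <= j < N.+1) p j * b j) ^+ 2) / (1 - q).
  have half (f : nat -> R) :
      \sum_(0 <= j < N.+1) p j * f j ^+ 2
      <= S * \sum_(0 <= k < N)
           q * (k.+1%:R * (k%:R + r)) * p k * (f k.+1 - f k) ^+ 2
        + (\sum_(0 <= j < N.+1) p j * f j) ^+ 2 / (1 - q).
    have := geometric_poincare q r p q_gt0 q_lt1 r_gt0 pE f N.
    rewrite lerBlDr => /le_trans; apply; rewrite lerD2l ler_wpM2l ?sqr_ge0 //.
    (* The term [p 0 = 1 - q] alone bounds the truncated mass below, uniformly in [N]. *)
    have P_ge : 1 - q <= \sum_(0 <= j < N.+1) p j.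
      rewrite big_nat_recl // {1}/p pE expr0 mulr1 lerDl.
      by apply: sumr_ge0 => j _; exact/ltW/p_gt0.
    by rewrite lef_pV2 ?posrE // (lt_le_trans q1).
  have -> : \sum_(0 <= j < N.+1) p j * (a j ^+ 2 + b j ^+ 2) =
      \sum_(0 <= j < N.+1) p j * a j ^+ 2 + \sum_(0 <= j < N.+1) p j * b j ^+ 2.
    by rewrite -big_split; apply: eq_bigr => j _; rewrite /= mulrDr.
  apply: le_trans (lerD (half a) (half b)) _.
  rewrite addrACA -mulrDr -mulrDl lerD2r -mulrA ler_pM2l //.
  rewrite mulr_sumr -big_split le_eqVlt; apply/orP; left; apply/eqP.
  apply: eq_bigr => k _ /=; rewrite /e lamE /omega -!natr1.
  by field; rewrite gt_eqF.
have dE : dirichlet r lam mu a b = (\sum_(j <oo) (e j)%:E)%E by [].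
rewrite dE; have := @nneseries_ge0 R (fun j => (e j)%:E) predT 0
  (fun j _ _ => e_ge0 j).
case Ed : (\sum_(j <oo) (e j)%:E)%E => [d| |] // _; last by rewrite leey.
have e_le N : \sum_(0 <= j < N) e j <= d.
  rewrite -lee_fin -Ed -sumEFin; apply: nneseries_lim_ge => j _ _.
  by rewrite lee_fin.
have cvgX := cvg_series_nneseries _ _
  (fun j => mulr_ge0 (ltW (p_gt0 j)) (addr_ge0 (sqr_ge0 (a j)) (sqr_ge0 (b j))))
  norm1.
have : 1 <= S / mu ^+ 2 * d + (0 ^+ 2 + 0 ^+ 2) / (1 - q).
  have cvgM : (fun N => S / mu ^+ 2 * d
      + (series (fun j => p j * a j) N ^+ 2
         + series (fun j => p j * b j) N ^+ 2) / (1 - q)) @ \oo -->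
      S / mu ^+ 2 * d + (0 ^+ 2 + 0 ^+ 2) / (1 - q).
    apply: cvgD; first exact: cvg_cst.
    apply: cvgMl; apply: cvgD; rewrite expr2; under eq_cvg do rewrite expr2.
      exact: cvgM.
    exact: cvgM.
  apply: (ler_cvg_to cvgX cvgM); near=> n.
  (* [series u n] stops at index [n - 1], so [finite] is used at [n.-1]. *)
  have n_gt0 : (0 < n)%N by near: n; exact: nbhs_infty_gt.
  rewrite -(prednK n_gt0); apply: le_trans (finite n.-1) _.
  by rewrite lerD2r ler_wpM2l // divr_ge0 // ?sqr_ge0 // ltW.
rewrite expr0n /= addr0 mul0r addr0 lee_fin ler_pdivrMr //.
have -> : d * S = S / mu ^+ 2 * d * mu ^+ 2 by field; rewrite gt_eqF.
by rewrite ler_pMl // exprn_gt0.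
Unshelve. all: by end_near. Qed.

(** * The gap bound and its integral form *)

Theorem theorem6p10 (R : realType) (r lam mu : R) :
  0 < r -> 0 < lam -> lam < mu ->
  let nu := lam / mu in
  exists S : R,
    series (fun k : nat => nu ^+ (2 * k) / (k%:R + r)) @ \oo --> S /\
    ((mu ^+ 2 / S)%:E <= gap r lam mu)%E /\
    (lebesgue_measure).-integrable `[0, nu]
       (fun s : R => (powR s (2 * r - 1) / (1 - s ^+ 2))%:E) /\
    mu ^+ 2 / S =
      mu ^+ 2 * powR nu (2 * r) /
      (2 * Rintegral lebesgue_measure `[0, nu]
             (fun s : R => powR s (2 * r - 1) / (1 - s ^+ 2))).
Proof.
move=> r_gt0 lam_gt0 lam_mu nu.
have mu_gt0 : 0 < mu := lt_trans lam_gt0 lam_mu.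
have nu_gt0 : 0 < nu by rewrite divr_gt0.
have nu_lt1 : nu < 1 by rewrite ltr_pdivrMr // mul1r.
have q_gt0 : 0 < nu ^+ 2 by rewrite exprn_gt0.
have q_lt1 : nu ^+ 2 < 1 by rewrite expr_lt1 // ltW.
exists (recip_sum (nu ^+ 2) r 0); split; last split; last split.
- have -> : (fun k : nat => nu ^+ (2 * k) / (k%:R + r)) =
      recip_geom (nu ^+ 2) r 0.
    by apply/funext => k; rewrite /recip_geom addr0 exprM.
  exact: is_cvg_recip.
- apply: le_ereal_inf_tmp => _ /= [[a b] /= adm <-].
  exact: dirichlet_lower_bound.
- exact: integrable_geometric_powR.
- have S_gt0 : 0 < recip_sum (nu ^+ 2) r 0 by exact: recip_sum_gt0.
  have nur_gt0 : 0 < nu `^ (2 * r) by rewrite powR_gt0.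
  (* Twice the integral is [nu^(2r)] times the series, so the powers of [nu] cancel. *)
  rewrite /Rintegral integral_geometric_powR //=.
  by field; rewrite !gt_eqF.
Qed.
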